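(* Let $p$ be an odd prime and $g\ge 1$ an integer. Let $I$ be the ideal of $\mathbb{F}_p[z_1,\ldots,z_{2g-1}]$ generated by the polynomials $c_{ip-j}$ for $1\le i,j\le g$. Then the scheme $\operatorname{Spec}\bigl(\mathbb{F}_p[z_1,\ldots,z_{2g-1}]/I\bigr)$ is reduced. (It is well known that this scheme is zero-dimensional (possibly empty), so that this is equivalent to saying that the scheme is nonsingular.)
   Context: Let $f(x)=x(x-1)(x-z_1)(x-z_2)\cdots(x-z_{2g-1})$ with $z_1,\ldots,z_{2g-1}$ indeterminates over $\mathbb{F}_p$. For an integer $k$, $c_k\in\mathbb{F}_p[z_1,\ldots,z_{2g-1}]$ denotes the coefficient of $x^k$ in $f(x)^{(p-1)/2}$ (so $c_k=0$ if $k<0$ or $k>(p-1)(2g+1)/2$). The polynomials $c_{ip-j}$, $1\le i,j\le g$, are the entries of the Cartier--Manin matrix of $y^2=f(x)$. *)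

(* Defs.v *)
From HB Require Import structures.
From mathcomp Require Import all_boot all_order all_algebra.
From mathcomp Require Import boolp classical_sets.
From mathcomp Require Import mpoly.
From mathcomp Require Import ring.

Set Implicit Arguments.
Unset Strict Implicit.
Unset Printing Implicit Defensive.

Import GRing.Theory.
Local Open Scope classical_set_scope.
Local Open Scope ring_scope.
Local Open Scope quotient_scope.

(* The ring quotients and the local rings of this file are comPzRingType (the
   zero ring is allowed): the ideals [idealr] of ring_quotient are proper and
   decidable, whereas the ideal of interest here may be the unit ideal. *)

Section Ideals.
Variable R : comPzRingType.

Definition ideal_closed (J : set R) : Prop :=
  [/\ J 0, forall x y, J x -> J y -> J (x + y) & forall a x, J x -> J (a * x)].

Record ideal := Ideal { ideal_set :> R -> Prop; idealP : ideal_closed ideal_set }.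

Definition ideal_pred (J : ideal) : {pred R} := fun x => x \in (ideal_set J : set R).

Lemma ideal_pred_zmod_closed (J : ideal) : zmod_closed (ideal_pred J).
Proof.
case: (idealP J) => J0 JD JM; split; first by rewrite unfold_in inE.
move=> x y; rewrite !unfold_in !inE => Jx Jy.
by apply: JD => //; rewrite -mulN1r; apply: JM.
Qed.

HB.instance Definition _ (J : ideal) :=
  GRing.isZmodClosed.Build R (ideal_pred J) (ideal_pred_zmod_closed J).

Lemma smallest_ideal_closed (S : set R) : ideal_closed (smallest ideal_closed S).
Proof.
split=> [J [[] //]|x y Sx Sy J HJ|a x Sx J HJ].
- by have [[_ JD _] _] := HJ; apply: JD; [apply: Sx|apply: Sy].
- by have [[_ _ JM] _] := HJ; apply: JM; apply: Sx.
Qed.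

Definition ideal_gen (S : set R) : ideal := Ideal (smallest_ideal_closed S).

Definition prime_ideal (P : ideal) : Prop :=
  ~ P 1 /\ forall x y, P (x * y) -> P x \/ P y.

Record Spec := SpecPoint { point :> ideal; pointP : prime_ideal point }.

End Ideals.

Section QuotientRing.
Variables (R : comPzRingType) (J : ideal R).

Definition quotient_ring : Type := Quotient.quot (ideal_pred J).

HB.instance Definition _ := GRing.Zmodule.on quotient_ring.
HB.instance Definition _ :=
  EqQuotient.copy quotient_ring (Quotient.quot (ideal_pred J)).

Definition residue (x : R) : quotient_ring := \pi_quotient_ring x.

Definition quotient_one : quotient_ring := residue 1.
Definition quotient_mul (x y : quotient_ring) : quotient_ring :=
  residue (repr x * repr y).

Lemma residue_eqP (x y : R) : residue x = residue y <-> J (x - y).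
Proof.
transitivity (x - y \in ideal_pred J : Prop); last by rewrite unfold_in inE.
by rewrite Quotient.idealrBE; split=> [/eqP|/eqP].
Qed.

Lemma residueP (x : quotient_ring) : exists a, x = residue a.
Proof. by exists (repr x); rewrite /residue reprK. Qed.

Lemma residueM x y : quotient_mul (residue x) (residue y) = residue (x * y).
Proof.
rewrite /quotient_mul; set x' := repr _; set y' := repr _.
have hx : J (x' - x) by apply/residue_eqP; rewrite /residue reprK.
have hy : J (y' - y) by apply/residue_eqP; rewrite /residue reprK.
apply/residue_eqP; have [_ JD JM] := idealP J.
have -> : x' * y' - x * y = y' * (x' - x) + x * (y' - y) by ring.
by apply: JD; apply: JM.
Qed.

Lemma residueD (x y : R) : residue (x + y) = residue x + residue y.
Proof. exact: (raddfD \pi_(Quotient.quot (ideal_pred J))). Qed.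

Lemma quotient_mulA : associative quotient_mul.
Proof.
move=> x y z; have [a ->] := residueP x; have [b ->] := residueP y.
by have [c ->] := residueP z; rewrite !residueM mulrA.
Qed.

Lemma quotient_mulC : commutative quotient_mul.
Proof.
move=> x y; have [a ->] := residueP x; have [b ->] := residueP y.
by rewrite !residueM mulrC.
Qed.

Lemma quotient_mul1 : left_id quotient_one quotient_mul.
Proof. by move=> x; have [a ->] := residueP x; rewrite residueM mul1r. Qed.

Lemma quotient_mulDl : left_distributive quotient_mul +%R.
Proof.
move=> x y z; have [a ->] := residueP x; have [b ->] := residueP y.
have [c ->] := residueP z.
by rewrite -residueD !residueM mulrDl residueD.
Qed.

HB.instance Definition _ := GRing.Zmodule_isComPzRing.Build quotient_ring
  quotient_mulA quotient_mulC quotient_mul1 quotient_mulDl.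

End QuotientRing.

Section LocalRing.
Variables (R : comPzRingType) (P : Spec R).

Definition denominator : Type := {s : R | s \notin ideal_pred P}.
HB.instance Definition _ := Choice.on denominator.

Lemma denom1_subproof : 1 \notin ideal_pred P.
Proof. by apply/negP; rewrite unfold_in inE; apply: (pointP P).1. Qed.
Definition denom1 : denominator := exist _ 1 denom1_subproof.

Lemma denomM_subproof (s t : denominator) : sval s * sval t \notin ideal_pred P.
Proof.
apply/negP; rewrite unfold_in inE => /(pointP P).2.
case: s t => s Hs [t Ht] /= [H|H].
- by move/negP: Hs; apply; rewrite unfold_in inE.
- by move/negP: Ht; apply; rewrite unfold_in inE.
Qed.
Definition denomM (s t : denominator) : denominator :=
  exist _ (sval s * sval t) (denomM_subproof s t).

(* R is not assumed to be a domain, hence the extra factor u. *)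
Definition frac_equiv (x y : R * denominator) : bool :=
  `[< exists u : denominator,
        sval u * (x.1 * sval y.2) = sval u * (y.1 * sval x.2) >].

Lemma frac_equiv_is_equiv : equiv_class_of frac_equiv.
Proof.
split=> [x|x y|y x z]; first by apply/asboolP; exists denom1.
- by apply/asboolP/asboolP => -[u uE]; exists u.
- move=> /asboolP[u uE] /asboolP[v vE]; apply/asboolP.
  exists (denomM (denomM u v) y.2) => /=.
  have -> : sval u * sval v * sval y.2 * (x.1 * sval z.2)
    = sval v * sval z.2 * (sval u * (x.1 * sval y.2)) by ring.
  have -> : sval u * sval v * sval y.2 * (z.1 * sval x.2)
    = sval u * sval x.2 * (sval v * (z.1 * sval y.2)) by ring.
  by rewrite uE -vE; ring.
Qed.

Canonical frac_equiv_rel := EquivRelPack frac_equiv_is_equiv.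
Canonical frac_encModRel := defaultEncModRel frac_equiv.

Definition local_ring : Type := {eq_quot frac_equiv}.

HB.instance Definition _ := Choice.on local_ring.
HB.instance Definition _ := EqQuotient.copy local_ring {eq_quot frac_equiv}.

Definition frac (a : R) (s : denominator) : local_ring := \pi_local_ring (a, s).

Definition local_zero : local_ring := frac 0 denom1.
Definition local_one : local_ring := frac 1 denom1.
Definition local_opp (x : local_ring) : local_ring :=
  frac (- (repr x).1) (repr x).2.
Definition local_add (x y : local_ring) : local_ring :=
  frac ((repr x).1 * sval (repr y).2 + (repr y).1 * sval (repr x).2)
       (denomM (repr x).2 (repr y).2).
Definition local_mul (x y : local_ring) : local_ring :=
  frac ((repr x).1 * (repr y).1) (denomM (repr x).2 (repr y).2).

Lemma frac_eqP (a b : R) (s t : denominator) :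
  frac a s = frac b t <->
  exists u : denominator, sval u * (a * sval t) = sval u * (b * sval s).
Proof.
split=> [/eqP|H]; first by rewrite eqmodE => /asboolP.
by apply/eqP; rewrite eqmodE; apply/asboolP.
Qed.

Lemma local_ringP (x : local_ring) : exists a s, x = frac a s.
Proof. by exists (repr x).1, (repr x).2; rewrite /frac -surjective_pairing reprK. Qed.

Lemma repr_fracP (a : R) (s : denominator) :
  exists u : denominator,
    sval u * ((repr (frac a s)).1 * sval s) = sval u * (a * sval (repr (frac a s)).2).
Proof. by apply/frac_eqP; rewrite /frac -surjective_pairing reprK. Qed.

Lemma local_oppE a s : local_opp (frac a s) = frac (- a) s.
Proof.
have [u uE] := repr_fracP a s; apply/frac_eqP; exists u.
by rewrite !mulNr !mulrN uE.
Qed.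

Lemma local_addE a s b t :
  local_add (frac a s) (frac b t) = frac (a * sval t + b * sval s) (denomM s t).
Proof.
rewrite /local_add; have [u uE] := repr_fracP a s; have [v vE] := repr_fracP b t.
set x := repr (frac a s) in uE *; set y := repr (frac b t) in vE *.
apply/frac_eqP; exists (denomM u v) => /=.
transitivity (sval v * sval t * sval y.2 * (sval u * (x.1 * sval s))
            + sval u * sval s * sval x.2 * (sval v * (y.1 * sval t))); first by ring.
by rewrite uE vE; ring.
Qed.

Lemma local_mulE a s b t :
  local_mul (frac a s) (frac b t) = frac (a * b) (denomM s t).
Proof.
rewrite /local_mul; have [u uE] := repr_fracP a s; have [v vE] := repr_fracP b t.
set x := repr (frac a s) in uE *; set y := repr (frac b t) in vE *.
apply/frac_eqP; exists (denomM u v) => /=.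
transitivity ((sval u * (x.1 * sval s)) * (sval v * (y.1 * sval t))); first by ring.
by rewrite uE vE; ring.
Qed.

Lemma local_addA : associative local_add.
Proof.
move=> x y z; have [a [s ->]] := local_ringP x.
have [b [t ->]] := local_ringP y; have [c [r ->]] := local_ringP z.
by rewrite !local_addE; apply/frac_eqP; exists denom1 => /=; ring.
Qed.

Lemma local_addC : commutative local_add.
Proof.
move=> x y; have [a [s ->]] := local_ringP x; have [b [t ->]] := local_ringP y.
by rewrite !local_addE; apply/frac_eqP; exists denom1 => /=; ring.
Qed.

Lemma local_add0 : left_id local_zero local_add.
Proof.
move=> x; have [a [s ->]] := local_ringP x.
by rewrite local_addE; apply/frac_eqP; exists denom1 => /=; ring.
Qed.

Lemma local_addN : left_inverse local_zero local_opp local_add.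
Proof.
move=> x; have [a [s ->]] := local_ringP x.
by rewrite local_oppE local_addE; apply/frac_eqP; exists denom1 => /=; ring.
Qed.

HB.instance Definition _ := GRing.isZmodule.Build local_ring
  local_addA local_addC local_add0 local_addN.

Lemma local_mulA : associative local_mul.
Proof.
move=> x y z; have [a [s ->]] := local_ringP x.
have [b [t ->]] := local_ringP y; have [c [r ->]] := local_ringP z.
by rewrite !local_mulE; apply/frac_eqP; exists denom1 => /=; ring.
Qed.

Lemma local_mulC : commutative local_mul.
Proof.
move=> x y; have [a [s ->]] := local_ringP x; have [b [t ->]] := local_ringP y.
by rewrite !local_mulE; apply/frac_eqP; exists denom1 => /=; ring.
Qed.

Lemma local_mul1 : left_id local_one local_mul.
Proof.
move=> x; have [a [s ->]] := local_ringP x.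
by rewrite local_mulE; apply/frac_eqP; exists denom1 => /=; ring.
Qed.

Lemma local_mulDl : left_distributive local_mul +%R.
Proof.
move=> x y z; have [a [s ->]] := local_ringP x.
have [b [t ->]] := local_ringP y; have [c [r ->]] := local_ringP z.
change (local_mul (local_add (frac a s) (frac b t)) (frac c r)
  = local_add (local_mul (frac a s) (frac c r))
              (local_mul (frac b t) (frac c r))).
rewrite local_addE !local_mulE local_addE.
by apply/frac_eqP; exists denom1 => /=; ring.
Qed.

HB.instance Definition _ := GRing.Zmodule_isComPzRing.Build local_ring
  local_mulA local_mulC local_mul1 local_mulDl.

End LocalRing.

Definition reduced_ring (R : comPzRingType) : Prop :=
  forall (x : R) (n : nat), x ^+ n = 0 -> x = 0.

(* A scheme is reduced when all its local rings are; the local ring of the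
   affine scheme Spec R at a prime P is the localization of R at P. *)
Definition reduced_Spec (R : comPzRingType) : Prop :=
  forall P : Spec R, reduced_ring (local_ring P).

Section CartierManin.
Variables (p g : nat).

Definition coef_ring : comNzRingType := {mpoly 'F_p[(2 * g).-1%N]}.

(* The indeterminate z_(k + 1), for k < 2g - 1. *)
Definition branch_point (k : 'I_(2 * g).-1%N) : coef_ring :=
  ('X_k : {mpoly 'F_p[(2 * g).-1%N]}).

Definition hyperelliptic_poly : {poly coef_ring} :=
  'X * ('X - 1) * \prod_(k < (2 * g).-1%N) ('X - (branch_point k)%:P).

Definition hasse_coef (k : int) : coef_ring :=
  if k is Posz m then (hyperelliptic_poly ^+ (p.-1)./2)`_m else 0.

Definition cartier_manin : 'M[coef_ring]_g :=
  \matrix_(i < g, j < g) hasse_coef ((i.+1 * p)%N%:Z - j.+1%:Z).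

Definition cartier_manin_ideal : ideal coef_ring :=
  ideal_gen [set h | exists i j, h = cartier_manin i j].

End CartierManin.

(* Main.v *)
Require Import Defs.
From HB Require Import structures.
From mathcomp Require Import all_boot all_algebra.
From mathcomp Require Import separable finfield boolp classical_sets mpoly.
From mathcomp Require Import zify ring.

(* Let R be the polynomial ring, I the ideal and h = f^((p-1)/2). At a maximal
   ideal M of R containing I the Jacobian matrix of the generators has full rank:
   - the operator L(u) = 2 f u' + f' u is linear over polynomials in x^p and
     kills h; if L(u) = 0 then (f u^2)' = 0, so for u nonzero f u^2 vanishes to
     order at least p at every root of f and u has large degree;
   - the vanishing of the c_(ip-j) makes truncations of h times polynomials in
     x^p into elements of small degree on which L takes values of degree < g.
     If f had a multiple root, these values would moreover be divisible by
     gcd(f, f'), and counting dimensions gives a nonzero element of the kernel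
     of too small degree. So f is separable, and the same argument shows that
     the kernel of the Cartier operator on the differentials c dx / y with
     deg c < 2g is the space of regular differentials;
   - for a tangent vector with variation w of f, every q w dx / y^3 with
     deg q < g is then congruent to d(b / y) modulo regular differentials, with
     deg b <= g and b f' = q w mod f. Comparing q = 1 and q = x^(g-1), the b of
     q = 1 has degree at most 1; as it vanishes at 0 and 1, w = 0.
   By Zariski's lemma R/M is finite, so z_k^q - z_k lies in M for some power q
   of p. Taylor expansion of h_k(z)^q = h_k(z^q) for elements h_k of I with
   Jacobian matrix 1 at M gives u outside M with u (a^q - a) in I for all a.
   Hence the annihilator modulo I of an a which is nilpotent modulo I lies in no
   maximal ideal. *)

Set Implicit Arguments.
Unset Strict Implicit.
Unset Printing Implicit Defensive.

Import GRing.Theory.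

Lemma odd_half_predE p : odd p -> p = p.-1./2.*2.+1.
Proof. by lia. Qed.

(** * The operator 2 f u' + f' u *)

Section HalfDerivation.
Local Open Scope ring_scope.
Variable F : fieldType.

(* [halfL f u = 2 f^(1/2) (f^(1/2) u)'], so the kernel of [halfL f] consists of
   the [u] for which [y u] is a constant of the derivation of the field of
   functions of the curve [y^2 = f]. *)
Definition halfL (f u : {poly F}) : {poly F} := f * u^`() *+ 2 + f^`() * u.

Lemma halfLD f u v : halfL f (u + v) = halfL f u + halfL f v.
Proof. by rewrite /halfL derivD !mulrDr mulrnDl addrACA. Qed.

Lemma halfLZ f a u : halfL f (a *: u) = a *: halfL f u.
Proof. by rewrite /halfL derivZ -!scalerAr scalerMnr -scalerDr. Qed.

Lemma halfL0 f : halfL f 0 = 0.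
Proof. by rewrite /halfL deriv0 !mulr0 mul0rn addr0. Qed.

Lemma halfL_sum f n (u : 'I_n -> {poly F}) :
  halfL f (\sum_i u i) = \sum_i halfL f (u i).
Proof. exact: (big_morph (halfL f) (halfLD f) (halfL0 f)). Qed.

Lemma size_halfL (f u : {poly F}) d : (size f <= d.+2)%N ->
  (size (halfL f u) <= size u + d)%N.
Proof.
move=> sf; case: (eqVneq u 0) => [->|u0]; first by rewrite halfL0 size_poly0.
have su : (0 < size u)%N by rewrite size_poly_gt0.
have sf' : (size f^`() <= d.+1)%N.
  by case: (eqVneq f 0) => [->|/lt_size_deriv]; rewrite ?deriv0 ?size_poly0; lia.
rewrite (leq_trans (size_polyD _ _)) // geq_max; apply/andP; split.
  rewrite mulr2n (leq_trans (size_polyD _ _)) // maxnn.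
  rewrite (leq_trans (size_polyMleq _ _)) //.
  by have := lt_size_deriv u0; lia.
by rewrite (leq_trans (size_polyMleq _ _)) //; lia.
Qed.

Lemma prod_exp_dvdp (G : {poly F}) (s : seq F) k : uniq s ->
  (forall r, r \in s -> ('X - r%:P) ^+ k %| G) ->
  \prod_(r <- s) ('X - r%:P) ^+ k %| G.
Proof.
elim: s => [|x s IH] /=; first by rewrite big_nil dvd1p.
move=> /andP[xs us] sG; rewrite big_cons Gauss_dvdp; last first.
  rewrite prodrXl coprimep_expl // coprimep_expr // coprimep_sym.
  by rewrite coprimep_XsubC root_prod_XsubC.
rewrite sG ?mem_head //= IH // => r rs; apply: sG.
by rewrite inE rs orbT.
Qed.

(** A root of multiplicity k is a root of the derivative at least k - 1 times. [G] serves as a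
    divisor of gcd(f, f') of known degree, the number of roots lost in [undup]. *)
Lemma prod_XsubC_rad (rs : seq F) :
  exists G : {poly F},
    \prod_(r <- rs) ('X - r%:P) = G * \prod_(r <- undup rs) ('X - r%:P)
    /\ G %| (\prod_(r <- rs) ('X - r%:P))^`().
Proof.
elim: rs => [|x s [G [EG dG]]] /=.
  by exists 1; rewrite mul1r dvd1p.
rewrite !big_cons derivM derivXsubC mul1r.
case: ifP => xs.
  exists (('X - x%:P) * G); split; first by rewrite EG mulrA.
  rewrite dvdp_add ?dvdp_mul // EG mulrC dvdp_mul //.
  by rewrite dvdp_XsubCl root_prod_XsubC mem_undup.
exists G; rewrite big_cons; split; first by rewrite EG mulrCA.
by rewrite dvdp_add ?dvdp_mull // EG dvdp_mulr.
Qed.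

End HalfDerivation.

(** * The kernel of the operator in odd characteristic *)

Section HalfPower.
Local Open Scope ring_scope.
Variables (F : fieldType) (p : nat).
Hypotheses (charF : p \in [pchar F]) (p_odd : odd p).
Let m := (p.-1)./2.

Let pE : p = m.*2.+1. Proof. exact: odd_half_predE. Qed.

Lemma natr_pchar_poly : (p%:R : {poly F}) = 0.
Proof. by rewrite -polyC_natr (pcharf0 charF). Qed.

Lemma derivXnM_pchar l : ('X^(l * p) : {poly F})^`() = 0.
Proof. by rewrite derivXn -mulr_natr natrM natr_pchar_poly !mulr0. Qed.

Lemma deriv_coef_pchar (u : {poly F}) i : (0 < i)%N -> u^`()`_(i * p - 1) = 0.
Proof.
move=> i0; have p0 : (0 < p)%N by rewrite pE.
have ip0 : (0 < i * p)%N by rewrite muln_gt0 i0.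
rewrite coef_deriv subn1 prednK // -mulr_natr natrM (pcharf0 charF).
by rewrite !mulr0.
Qed.

Lemma halfLMXn (f u : {poly F}) l : halfL f (u * 'X^(l * p)) = halfL f u * 'X^(l * p).
Proof. by rewrite /halfL derivM derivXnM_pchar; ring. Qed.

(** The value is (2m + 1) f^m f', and 2m + 1 = p. *)
Lemma halfL_half_power (f : {poly F}) : halfL f (f ^+ m) = 0.
Proof.
rewrite /halfL deriv_exp; case Em: m => [|k].
  by have := pcharf_prime charF; rewrite pE Em.
rewrite -pred_Sn; transitivity (f ^+ k.+1 * f^`() *+ p).
  by rewrite pE Em mulrnAr mulrCA -exprS -mulrnA muln2 -mulrSr mulrC.
by rewrite -mulr_natr natr_pchar_poly mulr0.
Qed.

(** The derivative of (X - r)^k q with q(r) nonzero vanishes only if k q(r) = 0, so p divides the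
    multiplicity k > 0. *)
Lemma deriv0_root_dvdp (G : {poly F}) r :
  G != 0 -> G^`() = 0 -> root G r -> ('X - r%:P) ^+ p %| G.
Proof.
move=> G0 dG rG; have [k [q]] := multiplicity_XsubC G r.
rewrite G0 /= => qr EG; case: k EG => [|k] EG.
  by move: qr; rewrite -[q]mulr1 -EG rG.
have : ('X - r%:P) ^+ k * (q^`() * ('X - r%:P) + q *+ k.+1) = 0.
  by rewrite -[RHS]dG EG derivM deriv_exp derivXsubC -pred_Sn exprS; ring.
move/eqP; rewrite mulf_eq0 expf_eq0 polyXsubC_eq0 andbF /= => /eqP/(congr1 (horner^~ r)).
rewrite !hornerE subrr mulr0 add0r => /eqP.
rewrite hornerMn -mulr_natr mulf_eq0 -[q.[r] == 0]/(root q r) (negPf qr) /=.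
rewrite -(dvdn_pcharf charF) => /(dvdn_leq (ltn0Sn k)) pk.
by rewrite EG dvdp_mull // dvdp_exp2l.
Qed.

Lemma halfL_ker_size (rs : seq F) (P : {poly F}) :
  P != 0 -> halfL (\prod_(r <- rs) ('X - r%:P)) P = 0 ->
  (size (undup rs) * p <= (size P).-1.*2 + size rs)%N.
Proof.
set f := \prod_(r <- rs) _ => P0 LP.
have f0 : f != 0 by rewrite monic_neq0 // monic_prod_XsubC.
have G0 : f * P ^+ 2 != 0 by rewrite mulf_neq0 // expf_neq0.
have dG : (f * P ^+ 2)^`() = 0.
  transitivity (P * halfL f P); last by rewrite LP mulr0.
  by rewrite /halfL derivM deriv_exp /=; ring.
have : \prod_(r <- undup rs) ('X - r%:P) ^+ p %| f * P ^+ 2.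
  apply: prod_exp_dvdp (undup_uniq rs) _ => r; rewrite mem_undup => rrs.
  by apply: deriv0_root_dvdp => //; rewrite rootM root_prod_XsubC rrs.
move/dvdp_leq => /(_ G0); rewrite prodrXl size_mul ?expf_neq0 // size_prod_XsubC.
have := size_exp (\prod_(r <- undup rs) ('X - r%:P)) p; rewrite size_prod_XsubC /=.
have := size_exp P 2; have := P0; have := expf_neq0 2 P0.
rewrite -!size_poly_gt0 => P2 _ EP <- le; rewrite -muln2 -EP; move: le P2.
by move: (size _) (size (P ^+ 2)) => a b; lia.
Qed.

End HalfPower.

(** * Vanishing Cartier-Manin matrix over a field *)

Lemma coefM_sum (R : comNzRingType) (a c : {poly R}) s i :
  (size c <= s)%N -> (s <= i.+1)%N ->
  ((a * c)`_i = \sum_(0 <= j < s) a`_(i - j) * c`_j)%R.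
Proof.
move=> cs si; rewrite coefMr -(big_mkord xpredT (fun j => a`_(i - j) * c`_j)%R).
rewrite (@big_cat_nat _ _ _ s) //= [X in (_ + X)%R]big_nat_cond [X in (_ + X)%R]big1 ?addr0 // => j.
by rewrite andbT => /andP[sj _]; rewrite (nth_default _ (leq_trans cs sj)) mulr0.
Qed.

Lemma size_polyM_leq (R : comNzRingType) (a b : {poly R}) i j :
  (size a <= i.+1)%N -> (size b <= j.+1)%N -> (size (a * b)%R <= (i + j).+1)%N.
Proof.
move=> ai bj; rewrite (leq_trans (size_polyMleq _ _)) //.
by move: (size a) (size b) ai bj => c d; lia.
Qed.

Lemma coefM_top (R : comNzRingType) (a b : {poly R}) i j :
  (size a <= i.+1)%N -> (size b <= j.+1)%N -> ((a * b)`_(i + j) = a`_i * b`_j)%R.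
Proof.
move=> ai bj; rewrite (coefM_sum _ bj) ?ltnS ?leq_addl // big_nat_recr //= addnK.
rewrite big_nat_cond big1 ?add0r // => k; rewrite andbT => /andP[_ kj].
by rewrite nth_default ?mul0r // (leq_trans ai) //; lia.
Qed.

Section VanishingCartierManin.
Local Open Scope ring_scope.
Variables (F : fieldType) (p g : nat) (rs : seq F).
Hypotheses (charF : p \in [pchar F]) (p_odd : odd p).
Hypotheses (g_gt0 : (0 < g)%N) (size_rs : size rs = (2 * g).+1).
Let m := (p.-1)./2.
Let f := \prod_(r <- rs) ('X - r%:P).
Let h := f ^+ m.

Let pE : p = m.*2.+1. Proof. exact: odd_half_predE. Qed.

Let m_gt0 : (0 < m)%N.
Proof.
by have := pcharf_prime charF; rewrite lt0n; apply: contraTneq => m0; rewrite pE m0.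
Qed.

Let f_monic : f \is monic. Proof. exact: monic_prod_XsubC. Qed.

Let size_f : size f = (2 * g).+2.
Proof. by rewrite size_prod_XsubC size_rs. Qed.

Let h_monic : h \is monic. Proof. exact: monic_exp. Qed.

Let size_h : size h = ((2 * g).+1 * m).+1.
Proof.
have := size_exp f m; rewrite size_f /= => <-.
by rewrite prednK // size_poly_gt0 monic_neq0.
Qed.

(** Polynomials in X^p are constants of the derivation, so [halfL f] is linear over them;
    coordinates in a row vector let linear algebra over [F] produce kernel elements. *)
Definition pth_comb n (u : 'rV[F]_n) : {poly F} :=
  \sum_(l < n) u 0 l *: 'X^(l * p).

Lemma coef_pth_comb n (u : 'rV[F]_n) (l : 'I_n) : (pth_comb u)`_(l * p) = u 0 l.
Proof.
rewrite coef_sum (bigD1 l) //= coefZ coefXn eqxx mulr1 big1 ?addr0 // => k kl.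
by rewrite coefZ coefXn eqn_pmul2r ?pE // eq_sym (inj_eq val_inj) (negPf kl) mulr0.
Qed.

Lemma pth_comb_neq0 n (u : 'rV[F]_n) : u != 0 -> pth_comb u != 0.
Proof.
apply: contraNneq => u0; apply/eqP/rowP => l.
by rewrite -coef_pth_comb u0 coef0 mxE.
Qed.

Lemma size_pth_comb n (u : 'rV[F]_n) : (size (pth_comb u) <= n.-1 * p + 1)%N.
Proof.
rewrite (leq_trans (size_sum _ _ _)) //; apply/bigmax_leqP => l _.
rewrite (leq_trans (size_scale_leq _ _)) // size_polyXn addn1 ltnS leq_mul2r.
by have := ltn_ord l; lia.
Qed.

Lemma halfL_pth_comb n (u : 'rV[F]_n) : halfL f (h * pth_comb u) = 0.
Proof.
rewrite mulr_sumr halfL_sum big1 // => l _.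
by rewrite -scalerAr halfLZ halfLMXn // halfL_half_power // mul0r scaler0.
Qed.

(** The degree of [h] is gp + (m - g), so the truncation has degree at most m - g + (n - 1)p. Twice
    this plus 2g + 1 is exactly (2n - 1)p, to be played against the lower bound of
    [halfL_ker_size]. *)
Lemma drop_pth_comb n (u : 'rV[F]_n) : (n <= g)%N -> (g <= m)%N -> u != 0 ->
  drop_poly (g * p) (h * pth_comb u) != 0 /\
  ((size (drop_poly (g * p) (h * pth_comb u))).-1.*2 + size rs
    <= (n.*2.-1) * p)%N.
Proof.
move=> ng gm u0; have n0 : (0 < n)%N.
  by case: n u u0 {ng} => // u; rewrite thinmx0 eqxx.
have := size_pth_comb u; have := pth_comb_neq0 u0.
rewrite -!size_poly_gt0 size_drop_poly size_rs => c0 sc.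
rewrite size_monicM -?size_poly_gt0 // size_h.
move: (size _) c0 sc => c; rewrite pE.
case: n n0 ng u u0 => // n _ ng u u0 /=.
rewrite /= => c0 sc; have : (n * m.*2.+1 = (n * m).*2 + n)%N by lia.
have : (n * m <= g * m)%N by rewrite leq_mul2r; lia.
by split; nia.
Qed.

(** Write the product as Q + X^(gp) P. As [halfL f] kills it, X^(gp) L(P) = -L(Q); the t zeros just
    below degree gp shrink Q, and L raises sizes by at most 2g. *)
Lemma halfL_drop_pth_comb n (u : 'rV[F]_n) t : (t <= 2 * g)%N ->
  (forall k, (k < t)%N -> (h * pth_comb u)`_(g * p - k.+1) = 0) ->
  (size (halfL f (drop_poly (g * p) (h * pth_comb u))) <= 2 * g - t)%N.
Proof.
move=> t2g Ut; set U := h * _ in Ut *; set P := drop_poly _ _.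
case: (eqVneq (halfL f P) 0) => [->|LP0]; first by rewrite size_poly0.
have sQ : (size (take_poly (g * p) U) <= g * p - t)%N.
  apply/leq_sizeP => j jt; rewrite coef_take_poly; case: ifP => // jg.
  have -> : j = (g * p - (g * p - j.+1).+1)%N by lia.
  by apply: Ut; lia.
have := halfL_pth_comb u; rewrite -/U -(poly_take_drop (g * p) U) -/P.
rewrite halfLD halfLMXn // => /eqP; rewrite addr_eq0 => /eqP EQ.
have := size_halfL (take_poly (g * p) U) (eq_leq size_f).
rewrite EQ size_polyN size_mulXn // => /leq_trans/(_ (leq_add sQ (leqnn _))).
have : (2 * g <= g * p)%N by rewrite mulnC leq_mul2l pE; have := m_gt0; lia.
by move: (g * p)%N (size _) => a b; lia.
Qed.

Hypotheses (rs0 : 0 \in rs) (rs1 : 1 \in rs).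
Hypothesis h_vanish : forall i j, (0 < i <= g)%N -> (0 < j <= g)%N ->
  h`_(i * p - j) = 0.

(** If m < g, the degree of [h] is gp - (g - m), one of the indices of [h_vanish], although [h] is
    monic. *)
Lemma genus_le_half : (g <= m)%N.
Proof.
rewrite leqNgt; apply/negP => mg.
have := @h_vanish g (g - m)%N; rewrite g_gt0 leqnn subn_gt0 mg leq_subr.
move=> /(_ isT isT); have -> : (g * p - (g - m) = (size h).-1)%N.
  by rewrite size_h pE; nia.
by move/eqP; rewrite -lead_coefE (monicP h_monic) oner_eq0.
Qed.

Let gm := genus_le_half.

Lemma coef_half_powerMXn l k : (l < g)%N -> (k < p)%N ->
  (h * 'X^(l * p))`_(g * p - k.+1) = h`_((g - l) * p - k.+1).
Proof.
move=> lg kp; rewrite coefMXn ltnNge; have : (l.+1 * p <= g * p)%N by rewrite leq_mul2r lg orbT.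
rewrite mulSn mulnBl => lgp; rewrite ifF; last by lia.
by congr (_`_ _); lia.
Qed.

Lemma coef_pth_combM n (u : 'rV[F]_n) k : (n <= g)%N -> (k < p)%N ->
  (h * pth_comb u)`_(g * p - k.+1) = \sum_(l < n) u 0 l * h`_((g - l) * p - k.+1).
Proof.
move=> ng kp; rewrite mulr_sumr coef_sum; apply: eq_bigr => l _.
by rewrite -scalerAr coefZ coef_half_powerMXn // (leq_trans (ltn_ord l)).
Qed.

Lemma coef_pth_comb_vanish n (u : 'rV[F]_n) k : (n <= g)%N -> (k < g)%N ->
  (h * pth_comb u)`_(g * p - k.+1) = 0.
Proof.
move=> ng kg; rewrite coef_pth_combM //; last by rewrite pE; lia.
rewrite big1 // => l _; rewrite h_vanish ?mulr0 //.
by have := ltn_ord l; lia.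
Qed.

Lemma halfL_drop_pth_combE n (u : 'rV[F]_n) :
  halfL f (drop_poly (g * p) (h * pth_comb u))
    = \sum_(l < n) u 0 l *: halfL f (drop_poly (g * p) (h * 'X^(l * p))).
Proof.
rewrite mulr_sumr drop_poly_sum halfL_sum; apply: eq_bigr => l _.
by rewrite -scalerAr drop_polyZ halfLZ.
Qed.

Lemma pth_comb_delta n (l : 'I_n) : pth_comb (delta_mx 0 l) = 'X^(l * p).
Proof.
rewrite /pth_comb (bigD1 l) //= mxE !eqxx scale1r big1 ?addr0 // => k kl.
by rewrite mxE (negPf kl) andbF scale0r.
Qed.

Lemma pth_comb_ker n (u : 'rV[F]_n) : (n <= g)%N -> u != 0 ->
  halfL f (drop_poly (g * p) (h * pth_comb u)) = 0 ->
  (size (undup rs) <= n.*2.-1)%N.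
Proof.
move=> ng u0 Lu; have [P0 sP] := drop_pth_comb ng gm u0.
rewrite -(@leq_pmul2r p) ?pE //; rewrite -pE.
exact: leq_trans (halfL_ker_size charF p_odd P0 Lu) sP.
Qed.

Lemma vanishing_uniq : uniq rs.
Proof.
have [G [fG dG]] := prod_XsubC_rad rs; rewrite -/f in fG dG.
rewrite -[uniq rs]negbK -ltn_size_undup size_rs; apply/negP => lt_s.
(* If g < k, then [g - k] truncates to 0 and the final bound only says [s <= 1]; the distinct roots
   0 and 1 exclude this. *)
have s_gt1 : (1 < size (undup rs))%N.
  apply: (@uniq_leq_size _ [:: 0; 1]); first by rewrite /= inE eq_sym oner_eq0.
  by move=> x; rewrite !inE mem_undup => /orP[] /eqP->.
set s := size _ in lt_s s_gt1; pose k := ((2 * g).+1 - s)%N.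
have G0 : G != 0.
  by have := monic_neq0 f_monic; rewrite fG mulf_eq0 negb_or => /andP[].
have sG : (size G).-1 = k.
  have := size_f; rewrite fG size_mul //; last first.
    by rewrite monic_neq0 // monic_prod_XsubC.
  by rewrite size_prod_XsubC -/s /k; move: (size G) => a; lia.
pose E l := halfL f (drop_poly (g * p) (h * 'X^(l * p))).
have GE l : E l = (E l %/ G) * G.
  rewrite divpK // /E /halfL dvdp_add //; last by rewrite dvdp_mulr.
  by rewrite -mulr_natr dvdp_mulr // dvdp_mulr // fG dvdp_mulr.
have sE l : (l < (g - k).+1)%N -> (size (E l %/ G)%R <= g - k)%N.
  move=> lk; rewrite size_divp // sG leq_sub2r //.
  have := @halfL_drop_pth_comb _ (delta_mx 0 (Ordinal lk)) g (leq_pmull g (ltn0Sn 1)).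
  rewrite pth_comb_delta mul2n -addnn addnK; apply=> i ig.
  by rewrite -(pth_comb_delta (Ordinal lk)) coef_pth_comb_vanish // /k; lia.
(* One more row than columns: the quotients by [G] are linearly dependent. *)
pose M := \matrix_(l < (g - k).+1, i < g - k) (E l %/ G)`_i.
have /rowV0Pn[u] : kermx M != 0.
  rewrite kermx_eq0; apply/negP => /eqP rM.
  by have := rank_leq_col M; rewrite rM ltnn.
move=> /sub_kermxP uM u0.
have Lu : halfL f (drop_poly (g * p) (h * pth_comb u)) = 0.
  rewrite halfL_drop_pth_combE; under eq_bigr => l _ do rewrite -/(E l) GE scalerAl.
  rewrite -mulr_suml; apply/eqP; rewrite mulf_eq0; apply/orP; left; apply/eqP.
  apply/polyP => i; rewrite coef0 coef_sum.
  case: (ltnP i (g - k)) => ik.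
    transitivity ((u *m M) 0 (Ordinal ik)); last by rewrite uM mxE.
    by rewrite mxE; apply: eq_bigr => l _; rewrite coefZ mxE.
  rewrite big1 // => l _; rewrite coefZ nth_default ?mulr0 //.
  exact: leq_trans (sE l (ltn_ord l)) ik.
have ng : ((g - k).+1 <= g)%N by rewrite /k; lia.
(* For k <= g the bound reads 2g + 1 - k <= 2(g - k) + 1, against k > 0. *)
have := pth_comb_ker ng u0 Lu; rewrite -/s /k; lia.
Qed.

(* Up to the choice of bases, this is the bijectivity of the map induced by the
   Cartier operator from differentials of the second kind modulo regular ones. *)
Lemma vanishing_Cartier_ker (c : {poly F}) : (size c <= 2 * g)%N ->
  (forall i, (0 < i <= g)%N -> (h * c)`_(i * p - 1) = 0) -> (size c <= g)%N.
Proof.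
move=> sc hc; have g2p : (2 * g < p)%N by rewrite pE; have := gm; lia.
(* [N] holds the coefficients of [h] at the offsets g + 1 to 2g, beyond [h_vanish]. A row vector
   killed by [N] makes all 2g coefficients just below degree gp vanish, hence gives a kernel element
   and at most 2g - 1 roots instead of 2g + 1. *)
pose N : 'M_g := \matrix_(l, k) h`_((g - l) * p - (g + k).+1).
have freeN : row_free N.
  rewrite -kermx_eq0; apply/rowV0P => u /sub_kermxP uN.
  apply: contraTeq isT => u0.
  suff /(pth_comb_ker (leqnn g) u0) :
      halfL f (drop_poly (g * p) (h * pth_comb u)) = 0.
    by rewrite undup_id ?vanishing_uniq // size_rs; lia.
  apply/eqP; rewrite -size_poly_leq0 -(subnn (2 * g)).
  apply: halfL_drop_pth_comb => // k k2g.
  case: (ltnP k g) => kg; first exact: coef_pth_comb_vanish.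
  have kg' : (k - g < g)%N by lia.
  rewrite coef_pth_combM //; last by lia.
  transitivity ((u *m N) 0 (Ordinal kg')); last by rewrite uN mxE.
  by rewrite mxE; apply: eq_bigr => l _; rewrite mxE /= subnKC.
(* The lower half of [c] meets only vanishing coefficients of [h], so [hc] says that [N] kills the
   upper half. *)
pose v := \col_(k < g) c`_(g + k).
have Nv : N *m v = 0.
  apply/matrixP => l j; rewrite !mxE.
  have lg : (0 < g - l <= g)%N by have := ltn_ord l; lia.
  have gp : (p <= (g - l) * p)%N by rewrite leq_pmull; lia.
  transitivity (h * c)`_((g - l) * p - 1); last exact: hc.
  rewrite (coefM_sum _ sc); last by lia.
  rewrite (@big_cat_nat _ _ _ g) ?leq_pmull //=.
  rewrite [X in _ = X + _]big_nat_cond [X in _ = X + _]big1 ?add0r => [|k]; last first.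
    by rewrite andbT => /andP[_ kg]; rewrite -subnDA add1n h_vanish ?mul0r //; lia.
  rewrite -[X in \sum_(X <= _ < _) _]add0n big_addn mul2n -addnn addnK big_mkord.
  by apply: eq_bigr => k _; rewrite !mxE -subnDA add1n addnC.
have v0 : v = 0.
  by rewrite -[v]mul1mx -(mulVmx (etrans (esym (row_free_unit N)) freeN)) -mulmxA Nv mulmx0.
apply/leq_sizeP => j gj; case: (ltnP j (2 * g)) => j2g; last first.
  by rewrite nth_default // (leq_trans sc).
have jg : (j - g < g)%N by lia.
have := congr1 (fun A : 'cV_(_) => A (Ordinal jg) 0) v0.
by rewrite !mxE /= subnKC.
Qed.


Lemma vanishing_coprime_deriv : coprimep f f^`().
Proof. by have := separable_prod_XsubC rs; rewrite unlock vanishing_uniq. Qed.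

(** This is 2 d(b / y) = (2 f b' - b f') dx / y^3 multiplied by the constant y^p, where y^2 = f and
    [h] = y^(p-1); it uses 2m = -1. *)
Lemma deriv_mul_half_power (b : {poly F}) :
  (b * h)^`() *+ 2 = f ^+ m.-1 * (f * b^`() *+ 2 - b * f^`()).
Proof.
have m2 : (m.*2%:R : {poly F}) = -1.
  by apply/eqP; rewrite -addr_eq0 natr1 -pE natr_pchar_poly.
have fm : f ^+ m = f ^+ m.-1 * f by rewrite -exprSr prednK.
rewrite /h derivM deriv_exp fm mulrnDl mulrnAr -mulrnA muln2 -[_ *+ m.*2]mulr_natr m2.
by ring.
Qed.

(** * First-order deformations: [w] varies f, and m w f^(m-1) is the variation of [h] *)

Section Deformation.
Variable w : {poly F}.
Hypothesis size_w : (size w <= (2 * g).+1)%N.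
Hypothesis w_vanish : forall i j, (0 < i <= g)%N -> (0 < j <= g)%N ->
  (w * f ^+ m.-1)`_(i * p - j) = 0.

(* Up to a multiple of [d(b / y)] and a regular differential,
   [q w dx / y^3] is zero. *)
Lemma deformation_regular (q : {poly F}) : (size q <= g)%N ->
  exists b : {poly F}, (size b <= g.+1)%N /\ f %| b * f^`() - q * w.
Proof.
move=> sq.
have [b [sb /dvdpP[c0 Ec0]]] :
    exists b : {poly F}, (size b <= (2 * g).+1)%N /\ f %| q * w - b * f^`().
  have /Bezout_coprimepP[[u1 u2] /=] := vanishing_coprime_deriv.
  rewrite -size_poly_eq1 => /size_poly1P[c c0 Ec].
  have kc : (c^-1)%:P * c%:P = 1 :> {poly F} by rewrite -polyCM mulVf.
  (* f' is invertible modulo f; b is the remainder of q w / f'. *)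
  pose B := (c^-1)%:P * u2 * q * w; exists (B %% f); split.
    by rewrite -ltnS -size_f ltn_modp monic_neq0.
  have -> : B %% f = B - B %/ f * f by rewrite {2}(divp_eq B f); ring.
  apply/dvdpP; exists ((c^-1)%:P * u1 * q * w + B %/ f * f^`()).
  by rewrite -[q * w]mul1r -kc -Ec /B; ring.
have f0 : f != 0 by rewrite monic_neq0.
have sqw : (size (q * w)%R <= 3 * g)%N.
  by rewrite (leq_trans (size_polyMleq _ _)) //; lia.
have sf' : (size f^`() <= (2 * g).+1)%N.
  by have := lt_size_deriv f0; rewrite size_f.
have sbf' : (size (b * f^`())%R <= (4 * g).+1)%N.
  by rewrite (leq_trans (size_polyM_leq sb sf')) //; lia.
have sc0 : (size c0 <= 2 * g)%N.
  case: (eqVneq c0 0) => [->|c0n0]; first by rewrite size_poly0.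
  have : (size (c0 * f)%R <= (4 * g).+1)%N.
    rewrite -Ec0 (leq_trans (size_polyD _ _)) // geq_max size_polyN sbf' andbT.
    by rewrite (leq_trans sqw) //; lia.
  by rewrite size_Mmonic // size_f; move: (size c0) => a; lia.
(* With this [c], q w dx / y^3 = -2 d(b / y) + c dx / y. *)
pose c := c0 + b^`() *+ 2.
have sc : (size c <= 2 * g)%N.
  rewrite (leq_trans (size_polyD _ _)) // geq_max sc0 mulr2n.
  rewrite (leq_trans (size_polyD _ _)) // maxnn.
  by case: (eqVneq b 0) => [->|/lt_size_deriv]; rewrite ?deriv0 ?size_poly0; lia.
(* A derivative has no coefficient at ip - 1, and that of f^(m-1) q w is a combination of those in
   [w_vanish], as q has degree less than g. *)
have hc i : (0 < i <= g)%N -> (h * c)`_(i * p - 1) = 0.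
  move=> /[dup] ig /andP[i0 _].
  have -> : h * c = f ^+ m.-1 * (q * w) + (b * h)^`() *+ 2.
    rewrite deriv_mul_half_power -mulrDr; have -> : q * w = b * f^`() + c0 * f.
      by rewrite -Ec0; ring.
    by rewrite -[h]/(f ^+ m) -[m in LHS]prednK // exprSr /c; ring.
  rewrite coefD coefMn deriv_coef_pchar // mul0rn addr0.
  have -> : f ^+ m.-1 * (q * w) = w * f ^+ m.-1 * q by ring.
  have gip : (g <= (i * p - 1).+1)%N.
    have := leq_pmull p i0; have := gm; rewrite {1}pE.
    by move: (i * p)%N => ip; lia.
  rewrite (coefM_sum _ sq gip) big_mkord big1 // => j _.
  by rewrite -subnDA add1n w_vanish ?mul0r ?ltn_ord.
have sc' := vanishing_Cartier_ker sc hc.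
have Eb : b * f^`() - f * b^`() *+ 2 = q * w - f * c by rewrite -[q * w](subrK (b * f^`())) Ec0 /c; ring.
exists b; split; last by rewrite -opprB dvdpNr Ec0 dvdp_mull.
(* If d > g, the right side of [Eb] has degree less than d + 2g, where the left side has coefficient
   (2g + 1 - 2d) times the leading one of b. This is nonzero: d <= 2g and g <= m give 0 < 2d - 2g -
   1 < p. *)
rewrite leqNgt; apply/negP => gb; pose d := (size b).-1.
have sbE : size b = d.+1 by rewrite /d prednK //; lia.
have f_top : f`_(2 * g).+1 = 1 by have /monicP := f_monic; rewrite lead_coefE size_f.
have b'_top : (size b^`() <= d.-1.+1)%N.
  have b0 : b != 0 by rewrite -size_poly_gt0 sbE.
  by have := lt_size_deriv b0; lia.
have : (b * f^`() - f * b^`() *+ 2)`_(d + 2 * g) = 0.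
  rewrite Eb nth_default // (leq_trans (size_polyD _ _)) // geq_max size_polyN.
  rewrite (leq_trans sqw) /=; last by lia.
  by rewrite (leq_trans (size_polyM_leq (eq_leq size_f) (leq_trans sc' (leqSpred g)))) //; lia.
rewrite coefB coefMn coefM_top ?sbE //.
have -> : (d + 2 * g = (2 * g).+1 + d.-1)%N by lia.
rewrite coefM_top ?size_f // !coef_deriv prednK; last by lia.
rewrite f_top mul1r -mulrnA muln2 mulr_natr => /eqP; rewrite subr_eq0 eq_sym.
rewrite -subr_eq0 -mulrnBr; last by lia.
rewrite -mulr_natr mulf_eq0 -/d -lead_coefE lead_coef_eq0 -size_poly_eq0 sbE /=.
rewrite -(dvdn_pcharf charF) => /dvdn_leq; rewrite pE; have := gm; lia.
Qed.

Hypotheses (w0 : w.[0] = 0) (w1 : w.[1] = 0).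

Lemma deformation_trivial : w = 0.
Proof.
have [d [sd /[dup] fd fd']] : exists b : {poly F}, (size b <= g.+1)%N /\ f %| b * f^`() - w.
  have [|b] := @deformation_regular 1; first by rewrite size_poly1.
  by rewrite mul1r; exists b.
have [|b [sb fb]] := @deformation_regular 'X^(g.-1); first by rewrite size_polyXn prednK.
(* Both sides solve the same congruence modulo f, f' is invertible there, and their degrees are
   below that of f. *)
have Eb : b = 'X^(g.-1) * d.
  apply/eqP; rewrite -subr_eq0; apply: contraT => /dvdp_leq bd.
  have: f %| b - 'X^(g.-1) * d.
    rewrite -(Gauss_dvdpl _ vanishing_coprime_deriv).
    have -> : (b - 'X^(g.-1) * d) * f^`() = (b * f^`() - 'X^(g.-1) * w)
       - 'X^(g.-1) * (d * f^`() - w) by ring.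
    by rewrite dvdp_sub // dvdp_mull.
  move/bd; rewrite size_f => /leq_trans/(_ (size_polyD _ _)).
  have sX : (size ('X^(g.-1) : {poly F}) <= g.-1.+1)%N by rewrite size_polyXn.
  rewrite size_polyN leqNgt => /negP[]; rewrite gtn_max ltnS (leq_trans sb) /=; last by lia.
  by rewrite ltnS (leq_trans (size_polyM_leq sX sd)) //; lia.
(* The bound on b leaves d degree at most 1, while d vanishes at the simple roots 0 and 1 of f,
   where w does. *)
have d0 : d = 0.
  apply: contraTeq isT => d0; move: sb; rewrite Eb mulrC size_mulXn // => sd2.
  have root_d x : x \in rs -> w.[x] = 0 -> root d x.
    move=> xrs wx; have fx : root f x by rewrite root_prod_XsubC.
    have := dvdp_trans (_ : 'X - x%:P %| f) fd; rewrite !dvdp_XsubCl => /(_ fx).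
    rewrite rootE !hornerE wx subr0 mulf_eq0.
    by rewrite (negPf (coprimep_root vanishing_coprime_deriv fx)) orbF.
  have /(max_poly_roots d0) : all (root d) [:: 0; 1] by rewrite /= !root_d.
  by rewrite /= inE eq_sym oner_eq0 => /(_ isT); move: (size d) sd2 => k; lia.
move: fd; rewrite d0 mul0r sub0r dvdpNr => fw.
apply: contraTeq fw => wn0; apply/negP => /(dvdp_leq wn0).
by move/leq_trans/(_ size_w); rewrite size_f ltnn.
Qed.

End Deformation.
End VanishingCartierManin.

(** * Zariski's lemma *)

Section Zariski.
Local Open Scope ring_scope.

(** Every subring containing [zs] is everything, stated as an induction principle. *)
Definition ring_generated (K : pzRingType) (zs : seq K) : Prop :=
  forall P : K -> Prop, P 1 -> (forall z, z \in zs -> P z) ->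
  (forall x y, P x -> P y -> P (x - y)) -> (forall x y, P x -> P y -> P (x * y)) ->
  forall x, P x.

Definition algebraic_at (C : idomainType) (K : fieldType) (phi : C -> K) (z : K) : Prop :=
  exists2 q : {poly C}, q != 0 & root (map_poly phi q) z.

Variable K : fieldType.

(** Multiplying a relation of degree d + 1 with leading coefficient b by b^d makes it monic in b
    z. *)
Lemma algebraic_integral (C : idomainType) (phi : {rmorphism C -> K}) z :
  injective phi -> algebraic_at phi z ->
  exists2 b : C, b != 0 & integralOver phi (phi b * z).
Proof.
move=> phi_inj [q q0 qz]; exists (lead_coef q); first by rewrite lead_coef_eq0.
have [d sq] : exists d, size q = d.+2.
  case E: (size q) => [|[|d]]; last by exists d.
    by move/eqP: E q0; rewrite size_poly_eq0 => ->.
  case/eqP/size_poly1P: E qz => c c0 ->; rewrite map_polyC rootC -(rmorph0 phi).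
  by rewrite (inj_eq phi_inj) (negPf c0).
set b := lead_coef q; have bE : b = q`_d.+1 by rewrite /b lead_coefE sq.
exists (\poly_(i < d.+2) (if i == d.+1 then 1 else q`_i * b ^+ (d - i))).
  by rewrite monicE lead_coef_poly //= eqxx ?oner_eq0.
rewrite rootE; apply/eqP; transitivity (phi b ^+ d * (map_poly phi q).[z]); last first.
  by rewrite (eqP (qz : _ == 0)) mulr0.
rewrite !(@horner_coef_wide _ d.+2) ?(leq_trans (size_poly _ _)) ?sq ?size_poly //.
rewrite mulr_sumr; apply: eq_bigr => i _.
rewrite !coef_map coef_poly ltn_ord exprMn /=; case: eqP => [Ei|/eqP ni].
  by rewrite Ei -bE rmorph1 exprS; ring.
have le_id : (i <= d)%N by have := ltn_ord i; lia.
rewrite rmorphM rmorphXn /=.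
have -> : phi b ^+ d = phi b ^+ (d - i) * phi b ^+ i by rewrite -exprD subnK.
by ring.
Qed.

Lemma algebraic_integral_seq (C : idomainType) (phi : {rmorphism C -> K}) (zs : seq K) :
  injective phi -> (forall z, z \in zs -> algebraic_at phi z) ->
  exists2 b : C, b != 0 & forall z, z \in zs -> integralOver phi (phi b * z).
Proof.
move=> phi_inj; elim: zs => [|x s IH] alg_s; first by exists 1; rewrite ?oner_eq0.
have [|b b0 bs] := IH; first by move=> z zs_z; apply: alg_s; rewrite inE zs_z orbT.
have [c c0 cx] := algebraic_integral phi_inj (alg_s x (mem_head x s)).
exists (b * c) => [|z]; first by rewrite mulf_neq0.
rewrite inE rmorphM => /orP[/eqP->|z_s].
  by rewrite -mulrA; apply: integral_mul => //; apply: integral_id.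
by rewrite mulrAC; apply: integral_mul; [apply: bs|apply: integral_id].
Qed.

Lemma ring_generated_integral (C : idomainType) (phi : {rmorphism C -> K})
    (zs : seq K) (b : C) : ring_generated zs ->
  (forall z, z \in zs -> integralOver phi (phi b * z)) ->
  forall y, exists N, integralOver phi (phi (b ^+ N) * y).
Proof.
move=> gen bz; apply: gen => [|z z_s|x y [M Mx] [N Ny]|x y [M Mx] [N Ny]].
- by exists 0%N; rewrite mulr1; apply: integral_id.
- by exists 1%N; rewrite expr1; apply: bz.
- exists (M + N)%N; rewrite exprD rmorphM mulrBr; apply: integral_sub.
    by rewrite mulrAC; apply: integral_mul => //; apply: integral_id.
  by rewrite -mulrA; apply: integral_mul => //; apply: integral_id.
- exists (M + N)%N; rewrite exprD rmorphM mulrACA.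
  exact: integral_mul.
Qed.

(** Clear denominators in a monic equation for a / s: every term except a^d is a multiple of s. *)
Lemma integral_fraction_dvd (C : idomainType) (phi : {rmorphism C -> K}) (a s : C) :
  injective phi -> s != 0 -> integralOver phi (phi a / phi s) ->
  exists k c, a ^+ k = s * c.
Proof.
move=> phi_inj s0 [P P_monic]; have ps0 : phi s != 0 by rewrite -(rmorph0 phi) (inj_eq phi_inj).
have [d sP] : exists d, size P = d.+1.
  by exists (size P).-1; rewrite prednK // size_poly_gt0 monic_neq0.
rewrite rootE (@horner_coef_wide _ d.+1) ?(leq_trans (size_poly _ _)) ?sP //.
move=> /eqP/(congr1 ( *%R (phi s ^+ d))); rewrite mulr0 mulr_sumr => E.
have {}E : \sum_(i < d.+1) P`_i * a ^+ i * s ^+ (d - i) = 0.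
  apply: phi_inj; rewrite rmorph0 -[RHS]E rmorph_sum; apply: eq_bigr => i _.
  have le_id : (i <= d)%N by have := ltn_ord i; lia.
  rewrite coef_map /= !rmorphM !rmorphXn /= expr_div_n.
  have -> : phi s ^+ d = phi s ^+ (d - i) * phi s ^+ i by rewrite -exprD subnK.
  by field; rewrite expf_neq0.
exists d, (- \sum_(i < d) P`_i * a ^+ i * s ^+ (d - i).-1).
move/monicP: P_monic; rewrite lead_coefE sP /= => Pd.
move: E; rewrite big_ord_recr /= Pd mul1r subnn mulr1 => /eqP.
rewrite addrC addr_eq0 => /eqP->; rewrite mulrN mulr_sumr; congr (- _).
apply: eq_bigr => i _; rewrite mulrCA -exprS prednK // subn_gt0; exact: ltn_ord.
Qed.

(** Modulo 1 + t b one has -t b = 1, so b^k is invertible there; being also zero there, it makes the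
    quotient trivial. *)
Lemma unit_of_mul_dvd (C : comUnitRingType) (t b c : C) k :
  b ^+ k = (1 + t * b) * c -> 1 + t * b \is a GRing.unit.
Proof.
move=> Eb; have [e Ee] : exists e, (- t * b) ^+ k = 1 - (1 + t * b) * e.
  elim: k {Eb} => [|k [e Ee]]; first by exists 0; rewrite mulr0 subr0.
  by exists (1 - t * b * e); rewrite exprS Ee; ring.
apply/unitrPr; exists (e + (- t) ^+ k * c).
by move: Ee; rewrite exprMn Eb mulrDr => E; rewrite mulrCA E; ring.
Qed.

(* A polynomial ring C in at least one variable t has no localization C[1/b]
   which is a field, as 1 + t b is not a unit of C. *)
Lemma not_ring_generated (C : idomainType) (phi : {rmorphism C -> K}) (zs : seq K) (t : C) :
  injective phi -> (forall b, b != 0 -> 1 + t * b != 0 /\ 1 + t * b \isn't a GRing.unit) ->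
  (forall z, z \in zs -> algebraic_at phi z) -> ~ ring_generated zs.
Proof.
move=> phi_inj tC alg_zs gen.
have [b b0 bz] := algebraic_integral_seq phi_inj alg_zs.
have [s0 /negP[]] := tC b b0.
have [N /(integral_fraction_dvd phi_inj s0)[k [c]]] :=
  ring_generated_integral gen bz (phi (1 + t * b))^-1.
by rewrite -exprM => /unit_of_mul_dvd.
Qed.

(** Transcendental members of [zs] are adjoined one at a time: [{poly D}] embeds in [K] by
    evaluation, and [t] is the last variable, in which 1 + t b has positive degree. *)
Lemma algebraic_or_transcendental (C : idomainType) (phi : {rmorphism C -> K}) (zs : seq K) :
  injective phi -> (forall z, z \in zs -> algebraic_at phi z) \/
  exists (D : idomainType) (psi : {rmorphism D -> K}) (t : D),
   [/\ injective psi, forall b, b != 0 -> 1 + t * b != 0 /\ 1 + t * b \isn't a GRing.unit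
     & forall z, z \in zs -> algebraic_at psi z].
Proof.
have extend (D : idomainType) (psi : {rmorphism D -> K}) x s :
    injective psi -> (forall z, z \in s -> algebraic_at psi z) -> ~ algebraic_at psi x ->
    exists (D : idomainType) (psi : {rmorphism D -> K}) (t : D),
     [/\ injective psi, forall b, b != 0 -> 1 + t * b != 0 /\ 1 + t * b \isn't a GRing.unit
       & forall z, z \in x :: s -> algebraic_at psi z].
  move=> psi_inj alg_s trans_x.
  have cx : commr_rmorph psi x by move=> ?; apply: mulrC.
  exists {poly D}, (horner_morph cx), 'X; split=> [|b b0|z].
  - apply: raddf_inj => q q0; apply: contra_notP trans_x => /eqP qn0.
    by exists q => //; rewrite rootE; apply/eqP.
  - have sb : size (1 + 'X * b) = (size b).+1.
      by rewrite addrC mulrC size_polyDl size_mulX ?size_poly1 // ltnS size_poly_gt0.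
    by rewrite -size_poly_gt0 poly_unitE sb eqSS size_poly_eq0 (negPf b0).
  - rewrite inE => /orP[/eqP->|/alg_s[q q0 qz]].
      exists ('X - ('X)%:P); first by rewrite polyXsubC_eq0.
      by rewrite map_polyXsubC root_XsubC /= horner_morphX.
    exists (map_poly polyC q); first by rewrite map_poly_eq0_id0 // polyC_eq0 lead_coef_eq0.
    rewrite -map_poly_comp.
    rewrite (@eq_map_poly _ _ _ psi) // => c /=; exact: horner_morphC.
move=> phi_inj; elim: zs => [|x s [alg_s|[D [psi [t [psi_inj tD alg_s]]]]]]; first by left.
- have [alg_x|trans_x] := pselect (algebraic_at phi x).
    by left=> z; rewrite inE => /orP[/eqP->|/alg_s].
  by right; apply: extend alg_s trans_x.
- right; have [alg_x|trans_x] := pselect (algebraic_at psi x).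
    exists D, psi, t; split=> // z; rewrite inE => /orP[/eqP->|/alg_s] //.
  exact: extend alg_s trans_x.
Qed.

Lemma ring_generated_algebraic (C : fieldType) (phi : {rmorphism C -> K}) (zs : seq K) :
  ring_generated zs -> forall z, z \in zs -> algebraic_at phi z.
Proof.
move=> gen; have [//|[D [psi [t [psi_inj tD alg_zs]]]]] :=
  algebraic_or_transcendental zs (fmorph_inj phi).
by have := not_ring_generated psi_inj tD alg_zs gen.
Qed.

End Zariski.

(** * Finite generation over the prime field *)

Section FinitePrimeField.
Local Open Scope ring_scope.
Variables (p : nat) (K : fieldType) (iota : {rmorphism 'F_p -> K}).
Hypothesis p_prime : prime p.

Lemma pchar_rmorph_Fp : p \in [pchar K].
Proof. by rewrite (fmorph_pchar iota) pchar_Fp. Qed.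

(** Frobenius preserves the finite set of roots of q, so two iterates of z agree; its injectivity
    cancels the smaller one. *)
Lemma algebraic_Fp_root z : algebraic_at iota z ->
  exists2 e, (0 < e)%N & z ^+ (p ^ e) = z.
Proof.
have charK := pchar_rmorph_Fp.
move=> [q q0 qz]; have q0' : map_poly iota q != 0 by rewrite map_poly_eq0.
have qFrob i : root (map_poly iota q) (z ^+ (p ^ i)).
  elim: i => [|i IH]; first by rewrite expn0 expr1.
  have EF : map_poly (pFrobenius_aut charK) (map_poly iota q) = map_poly iota q.
    rewrite -map_poly_comp; apply: eq_map_poly => a /=.
    by rewrite pFrobenius_autE -rmorphXn -[in X in _ ^+ X](card_Fp p_prime) expf_card.
  rewrite expnSr exprM -(pFrobenius_autE charK) rootE -EF horner_map.
  by rewrite (eqP (IH : _ == 0)) rmorph0.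
pose s := mkseq (fun i => z ^+ (p ^ i)) (size (map_poly iota q)).
have /(uniqPn 0)[i [j [ij js]]] : ~~ uniq s.
  apply/negP => us; have /(max_poly_roots q0')/(_ us) : all (root (map_poly iota q)) s.
    by apply/allP => _ /mapP[i _ ->].
  by rewrite size_mkseq ltnn.
rewrite size_mkseq in js; rewrite !nth_mkseq ?(ltn_trans ij js) // => Ez.
exists (j - i)%N; first by rewrite subn_gt0.
move: Ez; rewrite -[in RHS](subnK (ltnW ij)) expnD exprM.
move: (j - i)%N => k; elim: i {ij js} => [|i IH]; first by rewrite !expr1.
rewrite !expnSr ![_ ^+ (_ * _)]exprM -!(pFrobenius_autE charK).
by move/fmorph_inj/IH.
Qed.

Lemma ring_generated_Fp_root (zs : seq K) : ring_generated zs ->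
  exists2 e, (0 < e)%N & forall z, z \in zs -> z ^+ (p ^ e) = z.
Proof.
move=> gen; have := ring_generated_algebraic iota gen.
have expP (z : K) e k : z ^+ (p ^ e) = z -> z ^+ (p ^ (e * k)) = z.
  move=> ze; elim: k => [|k IH]; first by rewrite muln0 expn0 expr1.
  by rewrite mulnS expnD exprM ze IH.
elim: zs {gen} => [|x s IH] alg; first by exists 1%N.
have [|e e0 es] := IH; first by move=> z z_s; apply: alg; rewrite inE z_s orbT.
have [k k0 kx] := algebraic_Fp_root (alg x (mem_head x s)).
exists (e * k)%N; first by rewrite muln_gt0 e0.
move=> z; rewrite inE => /orP[/eqP->|/es]; last exact: expP.
by rewrite mulnC; apply: expP.
Qed.

End FinitePrimeField.

(** * Maximal ideals and residue fields *)

Section Ideals.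
Local Open Scope ring_scope.
Local Open Scope classical_set_scope.

Section IdealTheory.
Variables (R : comPzRingType) (J : ideal R).

Lemma ideal0 : J 0. Proof. by have [] := idealP J. Qed.

Lemma idealD x y : J x -> J y -> J (x + y).
Proof. by have [_ JD _] := idealP J; apply: JD. Qed.

Lemma idealMl a x : J x -> J (a * x).
Proof. by have [_ _ JM] := idealP J; apply: JM. Qed.

Lemma idealMr a x : J x -> J (x * a).
Proof. by rewrite mulrC; apply: idealMl. Qed.

Lemma idealN x : J x -> J (- x).
Proof. by rewrite -mulN1r; apply: idealMl. Qed.

Lemma idealB x y : J x -> J y -> J (x - y).
Proof. by move=> Jx Jy; apply/idealD/idealN. Qed.

Lemma ideal_sum (I : Type) (r : seq I) (P : pred I) (F : I -> R) :
  (forall i, P i -> J (F i)) -> J (\sum_(i <- r | P i) F i).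
Proof.
by move=> JF; apply: (big_ind (fun x => J x)); [apply: ideal0|apply: idealD|].
Qed.

End IdealTheory.

Lemma ideal_gen_in (R : comPzRingType) (S : set R) x : S x -> ideal_gen S x.
Proof. by move=> Sx J [_]; apply. Qed.

Lemma colon_ideal_closed (R : comPzRingType) (J : ideal R) (a : R) :
  ideal_closed [set u | J (u * a)].
Proof.
split=> [|x y /= Jx Jy|b x /= Jx] /=; first by rewrite mul0r; apply: ideal0.
- by rewrite mulrDl; apply: idealD.
- by rewrite -mulrA; apply: idealMl.
Qed.

Definition colon_ideal (R : comPzRingType) (J : ideal R) (a : R) : ideal R :=
  Ideal (colon_ideal_closed J a).

Definition maximal_ideal (R : comPzRingType) (M : ideal R) : Prop :=
  ~ M 1 /\ forall x, ~ M x -> exists y, M (y * x - 1).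

Lemma exists_maximal_ideal (R : comPzRingType) (Q : ideal R) : ~ Q 1 ->
  exists2 M : ideal R, maximal_ideal M & forall x, Q x -> M x.
Proof.
(* Zorn is applied to the sets X for which the union of Q and X is a proper ideal, so that the union
   of the empty chain qualifies. *)
move=> Q1; pose P : set (set R) :=
  [set X | ideal_closed (Q `|` X) /\ ~ (Q `|` X) 1].
have [F FP Ftot|A [[QA_closed QA1] A_max]] := @Zorn_bigcup R P.
  split; last by case=> // -[X FX X1]; have [_] := FP X FX; apply; right.
  have FC X (FX : F X) : ideal_closed (Q `|` X) := (FP X FX).1.
  split; first by left; apply: ideal0.
    move=> x y [Qx|[X FX Xx]] [Qy|[Y FY Yy]]; first by left; apply: idealD.
    + have [_ YD _] := FC Y FY; have [] := YD x y (or_introl Qx) (or_intror Yy).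
        by left.
      by right; exists Y.
    + have [_ XD _] := FC X FX; have [] := XD x y (or_intror Xx) (or_introl Qy).
        by left.
      by right; exists X.
    + have [XY|YX] := Ftot X Y FX FY.
        have [_ YD _] := FC Y FY.
        by have [] := YD x y (or_intror (XY _ Xx)) (or_intror Yy); [left|right; exists Y].
      have [_ XD _] := FC X FX.
      by have [] := XD x y (or_intror Xx) (or_intror (YX _ Yy)); [left|right; exists X].
  move=> a x [Qx|[X FX Xx]]; first by left; apply: idealMl.
  have [_ _ XM] := FC X FX.
  by have [] := XM a x (or_intror Xx); [left|right; exists X].
pose M := Ideal QA_closed; exists M; last by move=> x; left.
split=> // x Mx; apply: contrapT => nx.
pose B : set R := [set b | exists2 m, M m & exists r, b = m + r * x].
have MB m : M m -> B m by move=> Mm; exists m => //; exists 0; rewrite mul0r addr0.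
have QB : Q `|` B = B by apply/seteqP; split=> b; [case=> // Qb; apply: MB; left|right].
apply: (A_max B).
  split; first by move=> a Aa; apply: MB; right.
  move=> BA; apply: Mx; right; apply: BA; exists 0; first exact: ideal0.
  by exists 1; rewrite mul1r add0r.
rewrite /P /= QB; split.
  split; first by apply: MB; apply: ideal0.
    move=> _ _ [m Mm [r ->]] [n Mn [s ->]]; exists (m + n); first exact: idealD.
    by exists (r + s); rewrite mulrDl addrACA.
  move=> a _ [m Mm [r ->]]; exists (a * m); first exact: idealMl.
  by exists (a * r); rewrite mulrDr mulrA.
move=> [/Q1//|[m Mm [r E]]]; apply: nx; exists r.
by rewrite E opprD addrCA subrr addr0; apply: idealN.
Qed.

Lemma residue0 (R : comPzRingType) (J : ideal R) : residue J 0 = 0.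
Proof. exact: (raddf0 \pi_(Quotient.quot (ideal_pred J))%qT). Qed.

Lemma residue_eq0 (R : comPzRingType) (J : ideal R) x : residue J x = 0 <-> J x.
Proof. by rewrite -(residue0 J) residue_eqP subr0. Qed.

Section ResidueField.
Variables (R : comPzRingType) (M : ideal R) (M_max : maximal_ideal M).

(** The type carries the proof of maximality, on which the field structure depends. *)
Definition residue_field of maximal_ideal M : Type := quotient_ring M.
Local Notation K := (residue_field M_max).

HB.instance Definition _ := GRing.ComPzRing.on K.

Lemma residue_field_nonzero : (1 : K) != 0.
Proof.
apply/eqP => E; apply: M_max.1.
by apply/residue_eq0.
Qed.

HB.instance Definition _ :=
  GRing.PzSemiRing_isNonZero.Build K residue_field_nonzero.

Lemma residue_field_invP (x : K) :
  exists y : K, (x != 0 -> y * x = 1) /\ (x = 0 -> y = 0).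
Proof.
have [->|/eqP x0] := eqVneq x 0; first by exists 0; split.
have [a xa] := residueP (x : quotient_ring M).
have Ma : ~ M a.
  by move=> Ma; apply: x0; rewrite xa; apply/residue_eq0.
have [b Mb] := M_max.2 a Ma; exists (residue M b); split=> // _.
by rewrite xa; transitivity (residue M (b * a)); [apply: residueM|apply/residue_eqP].
Qed.

Definition residue_field_inv (x : K) : K := sval (cid (residue_field_invP x)).

Lemma residue_field_mulVf (x : K) : x != 0 -> residue_field_inv x * x = 1.
Proof. exact: (svalP (cid (residue_field_invP x))).1. Qed.

Lemma residue_field_inv0 : residue_field_inv 0 = 0.
Proof. exact: (svalP (cid (residue_field_invP 0))).2. Qed.

HB.instance Definition _ :=
  GRing.ComNzRing_isField.Build K residue_field_mulVf residue_field_inv0.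

Definition residue_map (x : R) : K := residue M x.

Lemma residue_map_additive : additive residue_map.
Proof.
move=> x y; apply/eqP; rewrite eq_sym subr_eq; apply/eqP.
by rewrite -[RHS]residueD subrK.
Qed.

Lemma residue_map_monoid : monoid_morphism residue_map.
Proof. by split=> // x y; apply: esym; apply: residueM. Qed.

HB.instance Definition _ := GRing.isAdditive.Build R K residue_map residue_map_additive.
HB.instance Definition _ := GRing.isMonoidMorphism.Build R K residue_map residue_map_monoid.

End ResidueField.

Lemma maximal_ideal_kernel (R : comPzRingType) (M : ideal R) : maximal_ideal M ->
  exists (K : fieldType) (pi : {rmorphism R -> K}),
    (forall y, exists x, pi x = y) /\ (forall x, pi x = 0 <-> M x).
Proof.
move=> M_max; exists (residue_field M_max), (residue_map M_max); split.
  by move=> y; have [x ->] := residueP (y : quotient_ring M); exists x.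
by move=> x; apply: residue_eq0.
Qed.

End Ideals.

(** * From radical ideals to reduced local rings *)

Section Reduced.
Local Open Scope ring_scope.

Lemma reduced_ring_Spec (R : comPzRingType) : reduced_ring R -> reduced_Spec R.
Proof.
move=> Rred P x n; have [a [s ->]] := local_ringP x => {x}.
have [t ->] : exists t, Defs.frac a s ^+ n = Defs.frac (a ^+ n) t.
  elim: n => [|n [t E]]; first by exists (denom1 P).
  by rewrite exprS E; exists (denomM s t); rewrite exprS -local_mulE.
move/frac_eqP => [u]; rewrite mul0r mulr0 mulr1 => uan.
(* The exponent n + 1 leaves a factor u to kill a^n even when n = 0. *)
have /Rred ua : (sval u * a) ^+ n.+1 = 0.
  rewrite exprS exprMn; transitivity (sval u ^+ n * a * (sval u * a ^+ n)); first by ring.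
  by rewrite uan mulr0.
by apply/frac_eqP; exists u; rewrite mul0r mulr0 mulr1.
Qed.

Lemma radical_ideal_reduced (R : comPzRingType) (J : ideal R) :
  (forall a n, J (a ^+ n) -> J a) -> reduced_ring (quotient_ring J).
Proof.
move=> Jrad x n; have [a ->] := residueP x.
have -> : residue J a ^+ n = residue J (a ^+ n).
  by elim: n => // n IH; rewrite !exprS IH; apply: residueM.
by move/residue_eq0/Jrad => Ja; apply/residue_eq0.
Qed.

End Reduced.

(** * Derivations and Frobenius on multivariate polynomials *)

Section MpolyDerivation.
Local Open Scope ring_scope.

Lemma mpoly_ring_ind n (R : comNzRingType) (P : {mpoly R[n]} -> Prop) :
  (forall c, P c%:MP) -> (forall i, P 'X_i) ->
  (forall u v, P u -> P v -> P (u + v)) -> (forall u v, P u -> P v -> P (u * v)) ->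
  forall u, P u.
Proof.
move=> PC PX PD PM; apply: mpolyind => [|c m u _ _ Pu]; first by rewrite -mpolyC0.
apply: (PD) => //; rewrite -mul_mpolyC; apply: (PM) => //.
have P1 : P 1 by rewrite -mpolyC1.
rewrite mpolyXE_id; elim/big_ind: _ => [//|u' v'|i _]; first exact: PM.
by elim: (m i) => [//|k IH]; rewrite exprS; apply: PM.
Qed.

Variables (n : nat) (R : comNzRingType) (l : 'I_n).
Local Notation A := {mpoly R[n]}.
Local Notation d := (map_poly (mderiv l)).

Lemma mderiv_var (i : 'I_n) : ('X_i : A)^`M(l) = (i == l)%:R.
Proof.
rewrite mderivX mnm1E; case: eqVneq => [->|_]; last by rewrite scale0r.
have -> : (U_(l) - U_(l) = 0)%MM by apply/mnmP => j; rewrite mnmBE mnm0E subnn.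
by rewrite scale1r mpolyX0.
Qed.

Lemma map_mderivM (u v : {poly A}) : d (u * v) = d u * v + u * d v.
Proof.
apply/polyP => i; rewrite coefD !coefM coef_map coefM raddf_sum -big_split /=.
by apply: eq_bigr => j _; rewrite mderivM !coef_map.
Qed.

Lemma map_mderivX (u : {poly A}) k : d (u ^+ k.+1) = u ^+ k * d u *+ k.+1.
Proof.
elim: k => [|k IH]; first by rewrite mul1r.
by rewrite exprS map_mderivM IH -mulrnAr mulrA -exprS [RHS]mulrS [d u * _]mulrC mulrnAr.
Qed.

Lemma map_mderiv_polyX : d ('X : {poly A}) = 0.
Proof.
apply/polyP => i; rewrite coef_map coefX coef0 /=.
by rewrite -mpolyC_nat mderivC.
Qed.

(** Chain rule; at a root of u it relates the variation of u to that of the root. *)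
Lemma mderiv_horner (u : {poly A}) x :
  (u.[x])^`M(l) = (d u).[x] + u^`().[x] * x^`M(l).
Proof.
elim/poly_ind: u => [|u c IH].
  by rewrite deriv0 !raddf0 !horner0 mderiv0 mul0r addr0.
rewrite hornerMXaddC mderivD mderivM IH derivD derivC derivM derivX raddfD /=.
rewrite map_mderivM map_mderiv_polyX map_polyC /= mulr0 !addr0 mulr1.
by rewrite hornerD hornerC hornerMX hornerD hornerMX; ring.
Qed.

End MpolyDerivation.

Section FrobeniusTaylor.
Local Open Scope ring_scope.
Variables (p n e : nat) (M : ideal {mpoly 'F_p[n]}).
Hypothesis p_prime : prime p.
Let q := (p ^ e)%N.
Hypothesis M_frob : forall l : 'I_n, M ('X_l ^+ q - 'X_l).

(** Since u^q is u evaluated at the X_l^q, this is a first-order Taylor expansion; the higher terms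
    carry further factors X_l^q - X_l, which [mu] absorbs. *)
Lemma frobenius_taylor (u : {mpoly 'F_p[n]}) :
  exists mu : 'I_n -> {mpoly 'F_p[n]}, (forall l, M (mu l)) /\
    u ^+ q - u = \sum_l (u^`M(l) + mu l) * ('X_l ^+ q - 'X_l).
Proof.
have charF : p \in [pchar {mpoly 'F_p[n]}].
  by apply: (rmorph_pchar (@mpolyC n 'F_p)); rewrite pchar_Fp.
have frobD (v w : {mpoly 'F_p[n]}) : (v + w) ^+ q = v ^+ q + w ^+ q.
  by apply: exprDn_pchar; rewrite pnatX (eq_pnat _ (pcharf_eq charF)) pnat_id.
elim/mpoly_ring_ind: u => [c|i|u v [mu [Mmu Eu]] [nu [Mnu Ev]]|u v [mu [Mmu Eu]] [nu [Mnu Ev]]].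
- exists (fun=> 0); split=> [l|]; first exact: ideal0.
  rewrite big1 => [|l _]; last by rewrite mderivC addr0 mul0r.
  apply/eqP; rewrite subr_eq0 -rmorphXn /=; apply/eqP; congr (_%:MP).
  rewrite /q; elim: (e) => [|k IH]; first by rewrite expr1.
  by rewrite expnSr exprM IH -[in X in _ ^+ X](card_Fp p_prime) expf_card.
- exists (fun=> 0); split=> [l|]; first exact: ideal0.
  rewrite (bigD1 i) //= mderiv_var eqxx addr0 mul1r big1 ?addr0 // => l li.
  by rewrite mderiv_var eq_sym (negPf li) addr0 mul0r.
- exists (fun l => mu l + nu l); split=> [l|]; first exact: idealD.
  rewrite frobD opprD addrACA Eu Ev -big_split /=; apply: eq_bigr => l _.
  by rewrite mderivD; ring.
- exists (fun l => (u ^+ q - u) * v^`M(l) + u ^+ q * nu l + v * mu l); split=> [l|].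
    apply: idealD; first apply: idealD; try exact: idealMl.
    by apply: idealMr; rewrite Eu; apply: ideal_sum => k _; apply: idealMl.
  transitivity (u ^+ q * (v ^+ q - v) + v * (u ^+ q - u)); first by rewrite exprMn; ring.
  rewrite [X in _ + v * X = _]Eu Ev !mulr_sumr -big_split /=; apply: eq_bigr => l _.
  by rewrite mderivM; ring.
Qed.

End FrobeniusTaylor.

(** * The Cartier-Manin ideal *)

Lemma prod_XsubC_01 (R : nzRingType) (s : seq R) :
  (\prod_(r <- [:: 0, 1 & s]) ('X - r%:P) = 'X * ('X - 1) * \prod_(r <- s) ('X - r%:P))%R.
Proof. by rewrite big_cons polyC0 subr0 big_cons mulrA. Qed.

Section CartierManinScheme.
Local Open Scope ring_scope.
Variables (p g : nat).
Hypotheses (p_prime : prime p) (p_odd : odd p) (g_gt0 : (0 < g)%N).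
Local Notation n := ((2 * g).-1)%N.
Local Notation R := {mpoly 'F_p[n]}.
Local Notation I := (cartier_manin_ideal p g : ideal R).
Local Notation CM := (cartier_manin p g : 'M[R]_g).
Local Notation f := (hyperelliptic_poly p g : {poly R}).
Let m := (p.-1)./2.

Let m_gt0 : (0 < m)%N.
Proof. by have := odd_prime_gt2 p_odd p_prime; rewrite /m; lia. Qed.

Lemma hyperelliptic_polyE :
  f = 'X * ('X - 1) * \prod_(k < n) ('X - ('X_k : R)%:P) :> {poly R}.
Proof. by []. Qed.

Let RS : seq R := [:: 0, 1 & [seq 'X_k | k : 'I_n]].

Lemma hyperelliptic_poly_prod : f = \prod_(r <- RS) ('X - r%:P).
Proof. by rewrite prod_XsubC_01 big_image. Qed.

Let size_hyperelliptic_poly : size f = (2 * g).+2.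
Proof.
by rewrite hyperelliptic_poly_prod size_prod_XsubC /= size_image card_ord; lia.
Qed.

Lemma cartier_maninE i j : CM i j =
  if (j < i.+1 * p)%N then (f ^+ m)`_(i.+1 * p - j.+1) else 0.
Proof.
rewrite mxE; case: ifP => ji; first by rewrite subzn.
by have -> : (i.+1 * p)%N%:Z - j.+1%:Z = Negz (j - i.+1 * p) by rewrite NegzE; lia.
Qed.

Lemma cartier_manin_in i j : I (CM i j).
Proof. by apply: ideal_gen_in; exists i, j. Qed.

(** * The Jacobian criterion at a maximal ideal containing [I] *)

Section AtMaximalIdeal.
Variables (M : ideal R) (K : fieldType) (pi : {rmorphism R -> K}).
Hypotheses (pi_surj : forall y, exists x, pi x = y) (pi_ker : forall x, pi x = 0 <-> M x).
Hypothesis IM : forall x, I x -> M x.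

Let rs : seq K := [:: 0, 1 & [seq pi 'X_k | k : 'I_n]].

Lemma map_hyperelliptic_poly : map_poly pi f = \prod_(r <- rs) ('X - r%:P).
Proof.
rewrite hyperelliptic_polyE 2!rmorphM rmorphB rmorph1 /= map_polyX rmorph_prod.
rewrite prod_XsubC_01 big_image; congr (_ * _); apply: eq_bigr => k _.
by rewrite rmorphB /= map_polyX map_polyC.
Qed.

Let size_rs : size rs = (2 * g).+1.
Proof. by rewrite /= size_image card_ord; lia. Qed.

Let charK : p \in [pchar K].
Proof. exact: (pchar_rmorph_Fp (pi \o @mpolyC n 'F_p)). Qed.

Let m_neq0 : m%:R != 0 :> K.
Proof.
rewrite -(dvdn_pcharf charK); apply/negP => /(dvdn_leq m_gt0).
by rewrite {1}(odd_half_predE p_odd) -/m; lia.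
Qed.

Let rs0 : 0 \in rs. Proof. by rewrite inE eqxx. Qed.
Let rs1 : 1 \in rs. Proof. by rewrite !inE eqxx orbT. Qed.

Let fK0 : (\prod_(r <- rs) ('X - r%:P)).[0] = 0.
Proof. by apply/eqP; rewrite -[_ == 0]/(root _ 0) root_prod_XsubC rs0. Qed.

Lemma cartier_manin_vanish i j : (0 < i <= g)%N -> (0 < j <= g)%N ->
  ((\prod_(r <- rs) ('X - r%:P)) ^+ m)`_(i * p - j) = 0.
Proof.
case: i j => [|i] [|j] //= ig jg; case: (ltnP j (i.+1 * p)) => ji.
  rewrite -map_hyperelliptic_poly -rmorphXn coef_map /=; apply/pi_ker/IM.
  by have := cartier_manin_in (Ordinal ig) (Ordinal jg); rewrite cartier_maninE /= ji.
(* Truncated subtraction sends a negative index to 0, where the coefficient vanishes because 0 is a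
   root. *)
have -> : (i.+1 * p - j.+1 = 0)%N by lia.
by rewrite -horner_coef0 horner_exp fK0 -[m]prednK // exprS mul0r.
Qed.

Local Notation fK := (\prod_(r <- rs) ('X - r%:P)).
Local Notation dK l P := (map_poly pi (map_poly (mderiv l) P)).

Lemma jacobian_coef l k :
  pi ((f ^+ m)`_k)^`M(l) = (dK l f * fK ^+ m.-1)`_k *+ m.
Proof.
have := coef_map (mderiv l) (f ^+ m) k => /= <-; rewrite -(coef_map pi) /=.
by rewrite -[m]prednK // map_mderivX rmorphMn rmorphM rmorphXn /= map_hyperelliptic_poly coefMn mulrC.
Qed.

Lemma size_mderiv_hyperelliptic_poly l : (size (dK l f) <= (2 * g).+1)%N.
Proof.
apply/leq_sizeP => j gj; rewrite !coef_map /=.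
have [->|nj] := eqVneq j (2 * g).+1.
  have : f \is monic by rewrite hyperelliptic_poly_prod monic_prod_XsubC.
  by rewrite monicE lead_coefE size_hyperelliptic_poly => /eqP->; rewrite -mpolyC1 mderivC rmorph0.
by rewrite nth_default ?mderiv0 ?rmorph0 // size_hyperelliptic_poly; lia.
Qed.

Lemma mderiv_hyperelliptic_poly_root l x : x \in RS ->
  (dK l f).[pi x] = - (fK^`().[pi x] * pi (x^`M(l))).
Proof.
move=> xRS; have fx : f.[x] = 0.
  by apply/eqP; rewrite hyperelliptic_poly_prod -[_ == 0]/(root _ x) root_prod_XsubC.
have := mderiv_horner l f x; rewrite fx mderiv0 => /esym/eqP.
rewrite addr_eq0 => /eqP E; rewrite horner_map E rmorphN rmorphM /= -horner_map.
by rewrite -deriv_map map_hyperelliptic_poly.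
Qed.

(** [a] moves the branch points and [w] is the induced variation of f, zero by
    [deformation_trivial]; its value at the k-th branch point is -a_k f', with f' nonzero at a
    simple root. *)
Lemma deformation_kernel (a : 'rV[K]_n) :
  (forall i j, \sum_l a 0 l * pi ((CM i j)^`M(l)) = 0) -> a = 0.
Proof.
move=> a_ker; pose w := \sum_l a 0 l *: dK l f.
have wE x : w.[x] = \sum_l a 0 l * (dK l f).[x].
  by rewrite horner_sum; apply: eq_bigr => l _; rewrite hornerZ.
have sw : (size w <= (2 * g).+1)%N.
  rewrite (leq_trans (size_sum _ _ _)) //; apply/bigmax_leqP => l _.
  exact: leq_trans (size_scale_leq _ _) (size_mderiv_hyperelliptic_poly l).
have w01 x : x = 0 \/ x = 1 -> w.[pi x] = 0.
  move=> x01; rewrite wE big1 // => l _.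
  rewrite mderiv_hyperelliptic_poly_root; last first.
    by case: x01 => ->; rewrite !inE eqxx ?orbT.
  have -> : x^`M(l) = 0 by case: x01 => ->; rewrite ?mderiv0 // -mpolyC1 mderivC.
  by rewrite rmorph0 mulr0 oppr0 mulr0.
have w0 : w.[0] = 0 by have := w01 0 (or_introl erefl); rewrite rmorph0.
have w1 : w.[1] = 0 by have := w01 1 (or_intror erefl); rewrite rmorph1.
have w_vanish i j : (0 < i <= g)%N -> (0 < j <= g)%N ->
    (w * fK ^+ m.-1)`_(i * p - j) = 0.
  case: i j => [|i] [|j] //= ig jg; case: (ltnP j (i.+1 * p)) => ji; last first.
    have -> : (i.+1 * p - j.+1 = 0)%N by lia.
    by rewrite -horner_coef0 hornerM w0 mul0r.
  have := a_ker (Ordinal ig) (Ordinal jg); rewrite cartier_maninE /= ji => E.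
  apply: (mulIf m_neq0); rewrite mul0r -[RHS]E mulr_natr mulr_suml coef_sum -sumrMnl.
  by apply: eq_bigr => l _; rewrite jacobian_coef -scalerAl coefZ mulrnAr.
have w_eq0 := deformation_trivial charK p_odd g_gt0 size_rs rs0 rs1
  cartier_manin_vanish sw w_vanish w0 w1.
apply/rowP => k; rewrite mxE.
have k_RS : 'X_k \in RS by rewrite !inE fintype.image_f ?orbT.
have pik : root fK (pi 'X_k) by rewrite root_prod_XsubC !inE fintype.image_f ?orbT.
have co := vanishing_coprime_deriv charK p_odd g_gt0 size_rs rs0 rs1 cartier_manin_vanish.
have := wE (pi 'X_k); rewrite w_eq0 horner0 (bigD1 k) //= big1 ?addr0 => [|l lk].
  rewrite mderiv_hyperelliptic_poly_root // mderiv_var eqxx rmorph1 mulr1 mulrN.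
  move/esym/eqP; rewrite oppr_eq0 mulf_eq0 (negPf (coprimep_root co pik)) orbF.
  by move/eqP.
rewrite mderiv_hyperelliptic_poly_root // mderiv_var eq_sym (negPf lk).
by rewrite rmorph0 mulr0 oppr0 mulr0.
Qed.

Lemma jacobian_right_inverse : exists h : 'I_n -> R,
  (forall k, I (h k)) /\ forall k l, pi ((h k)^`M(l)) = (k == l)%:R.
Proof.
pose J := \matrix_(l < n, t < g * g) pi ((mxvec CM 0 t)^`M(l)).
have /row_freeP[B JB] : row_free J.
  rewrite -kermx_eq0; apply/eqP/row_matrixP => i; rewrite row0.
  have /sub_kermxP aJ : (row i (kermx J) <= kermx J)%MS by apply: row_sub.
  apply: deformation_kernel => i1 j1.
  transitivity ((row i (kermx J) *m J) 0 (mxvec_index i1 j1)); last by rewrite aJ mxE.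
  by rewrite [RHS]mxE; apply: eq_bigr => l _; rewrite [J _ _]mxE mxvecE.
have I_CM t : I (mxvec CM 0 t).
  by case/mxvec_indexP: t => i j; rewrite mxvecE; apply: cartier_manin_in.
pose lift y := sval (cid (pi_surj y)).
have liftK y : pi (lift y) = y := svalP (cid (pi_surj y)).
exists (fun k => \sum_t lift (B t k) * mxvec CM 0 t); split=> [k|k l].
  by apply: ideal_sum => t _; apply: idealMl.
rewrite (raddf_sum (mderiv l)) rmorph_sum /=; transitivity ((J *m B) l k); last by rewrite JB mxE eq_sym.
rewrite [RHS]mxE; apply: eq_bigr => t _.
rewrite mderivM rmorphD !rmorphM liftK [J _ _]mxE.
(* The derivatives of the lifted coefficients drop out, their cofactors being zero at [M]. *)
have -> : pi (mxvec CM 0 t) = 0 := (pi_ker _).2 (IM (I_CM t)).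
by rewrite mulr0 add0r mulrC.
Qed.

(** By Taylor expansion, [G] applied to the X_l^q - X_l has entries h_k^q - h_k in [I], and [G] is
    the identity modulo [M]. So its determinant is outside [M], and the adjugate puts its multiples
    of X_l^q - X_l in [I]. *)
Lemma frobenius_power_local e : (forall k : 'I_n, M ('X_k ^+ (p ^ e) - 'X_k)) ->
  exists2 u, ~ M u & forall a, I (u * (a ^+ (p ^ e) - a)).
Proof.
move=> M_frob; have [h [Ih dh]] := jacobian_right_inverse.
have /choice[mu Hmu] := frobenius_taylor p_prime M_frob.
have M_mu a l : M (mu a l) := (Hmu a).1 l.
have muE a := (Hmu a).2.
pose G := \matrix_(k < n, l < n) ((h k)^`M(l) + mu (h k) l).
pose eps : 'cV[R]_n := \col_l ('X_l ^+ (p ^ e) - 'X_l).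
have p_gt0 : (0 < p ^ e)%N by rewrite expn_gt0 prime_gt0.
have I_G k : I ((G *m eps) k 0).
  have -> : (G *m eps) k 0 = h k ^+ (p ^ e) - h k.
    by rewrite muE mxE; apply: eq_bigr => l _; rewrite !mxE.
  by apply: idealB => //; rewrite -(prednK p_gt0) exprS; apply: idealMr.
exists (\det G).
  move/pi_ker; rewrite -det_map_mx; have -> : map_mx pi G = 1%:M.
    apply/matrixP => k l; rewrite !mxE rmorphD dh /=.
    have -> : pi (mu (h k) l) = 0 by apply/pi_ker.
    by rewrite addr0.
  by rewrite det1 => /eqP; rewrite oner_eq0.
move=> a; rewrite muE mulr_sumr; apply: ideal_sum => l _; rewrite mulrCA; apply: idealMl.
have -> : \det G * ('X_l ^+ (p ^ e) - 'X_l) = (\adj G *m (G *m eps)) l 0.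
  by rewrite mulmxA mul_adj_mx mul_scalar_mx !mxE.
by rewrite mxE; apply: ideal_sum => k _; apply: idealMl.
Qed.

Lemma residue_field_Frobenius : exists2 e, (0 < e)%N & forall k : 'I_n, M ('X_k ^+ (p ^ e) - 'X_k).
Proof.
have gen : ring_generated [seq pi 'X_k | k : 'I_n].
  move=> P P1 PX PB PM y; have [x <-] := pi_surj y.
  have P0 : P 0 by rewrite -(subrr 1); apply: (PB).
  have PN u : P u -> P (- u) by rewrite -sub0r; apply: (PB).
  have PD u v : P u -> P v -> P (u + v) by rewrite -{2}[v]opprK => Pu /PN; apply: (PB).
  elim/mpoly_ring_ind: x => [c|i|u v Pu Pv|u v Pu Pv].
  - rewrite -[c]natr_Zp mpolyC_nat rmorph_nat.
    by elim: (nat_of_ord _) => // k IH; rewrite mulrS; apply: (PD).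
  - by apply: PX; apply: fintype.image_f.
  - by rewrite rmorphD; apply: (PD).
  - by rewrite rmorphM; apply: (PM).
have [e e0 Ee] := ring_generated_Fp_root (pi \o @mpolyC n 'F_p) p_prime gen.
exists e => // k; apply/pi_ker; rewrite rmorphB rmorphXn /= Ee ?subrr //.
exact: fintype.image_f.
Qed.

End AtMaximalIdeal.

Lemma cartier_manin_ideal_radical (a : R) N : I (a ^+ N) -> I a.
Proof.
move=> IaN; pose Q := colon_ideal I a; apply: contrapT => Ia.
have [|M M_max QM] := @exists_maximal_ideal _ Q; first by rewrite /= mul1r.
have [K [pi [pi_surj pi_ker]]] := maximal_ideal_kernel M_max.
have IM x : I x -> M x by move=> Ix; apply: QM; apply: idealMr.
have [e e_gt0 M_frob] := residue_field_Frobenius pi_surj pi_ker.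
have [u Mu Iu] := frobenius_power_local pi_surj pi_ker IM M_frob.
apply/Mu/QM; change (I (u * a)).
(* Iterating the congruence raises the exponent of a to any power of p^e, hence beyond N. *)
have Iua k : I (u * a - u * a ^+ ((p ^ e) ^ k)).
  elim: k => [|k IH]; first by rewrite expn0 expr1 subrr; apply: ideal0.
  rewrite expnSr exprM; set b := a ^+ _ in IH *.
  have -> : u * a - u * b ^+ (p ^ e) = u * a - u * b - u * (b ^+ (p ^ e) - b) by ring.
  exact: idealB.
have Nq : (N <= (p ^ e) ^ N)%N.
  by apply/ltnW/ltn_expl; rewrite -(expn0 p) ltn_exp2l // prime_gt1.
rewrite -[u * a](subrK (u * a ^+ ((p ^ e) ^ N))).
apply: (idealD (Iua N)).
by rewrite -(subnK Nq) exprD mulrA; apply: idealMl.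
Qed.

End CartierManinScheme.

Theorem theoremC (p g : nat) (p_prime : prime p) (p_odd : odd p) (g_ge1 : 1 <= g) :
  reduced_Spec (quotient_ring (cartier_manin_ideal p g)).
Proof.
apply: reduced_ring_Spec; apply: radical_ideal_reduced => a N.
exact: cartier_manin_ideal_radical.
Qed.
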